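(* Let $(X,d)$ be a complete metric space with $|X|\geqslant 3$, let $k\in\mathbb{N}$ with $3\leqslant k\leqslant |X|$, and let $T\colon X\to X$ be a Kannan-type perimetric contraction on $k$-polygons in $X$. If $T$ has no periodic points of prime period $i$ for any $i\in\{2,3,\ldots,k-1\}$, then $T$ has a fixed point in $X$. Moreover, $T$ has at most $k-1$ fixed points.
   Context: $|X|$ denotes the cardinality of $X$ (possibly infinite). For points $x_1,\ldots,x_k$ of a metric space $(X,d)$, $k\geqslant 3$, put $P(x_1,x_2,\ldots,x_k)=d(x_1,x_2)+d(x_2,x_3)+\cdots+d(x_{k-1},x_k)+d(x_k,x_1)$. For $3\leqslant k\leqslant|X|$, a map $T\colon X\to X$ is a Kannan-type perimetric contraction on $k$-polygons in $X$ if there exists $\mu\in[0,\frac{2}{k})$ such that $P(Tx_1,\ldots,Tx_k)\leqslant\mu\big(d(x_1,Tx_1)+d(x_2,Tx_2)+\cdots+d(x_k,Tx_k)\big)$ for all $k$ pairwise distinct points $x_1,\ldots,x_k\in X$. A point $x\in X$ is a periodic point of period $p$ if $T^p x=x$; its prime period is the least positive integer $p$ with $T^p x=x$. *)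

(* Defs.v *)
From HB Require Import structures.
From mathcomp Require Import all_boot all_order all_algebra.
From mathcomp Require Import all_classical all_reals all_analysis.

Set Implicit Arguments.
Unset Strict Implicit.
Unset Printing Implicit Defensive.

Import Order.TTheory GRing.Theory Num.Theory.
Import numFieldNormedType.Exports.

Local Open Scope classical_set_scope.
Local Open Scope ring_scope.

(* A property of X rather than a completeType structure, since completeType
   also requires a distinguished point. *)
Definition complete_metric (R : realType) (X : metricType R) : Prop :=
  forall u : nat -> X, cauchy (u @ \oo) -> exists l : X, u @ \oo --> l.

(* ordS is the cyclic successor on 'I_k, so the last term of the sum is
   d(x_k, x_1). *)
Definition perimeter (R : realType) (X : metricType R) (k : nat)
    (x : 'I_k -> X) : R :=
  \sum_(i < k) mdist (x i) (x (ordS i)).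

Definition kannan_perimetric_contraction (R : realType) (X : metricType R)
    (k : nat) (T : X -> X) : Prop :=
  exists mu : R, [/\ 0 <= mu, mu < 2 / k%:R &
    forall x : 'I_k -> X, injective x ->
      perimeter (T \o x) <= mu * \sum_(i < k) mdist (x i) (T (x i))].

Definition periodic_point (X : Type) (T : X -> X) (p : nat) (x : X) : Prop :=
  iter p T x = x.

Definition has_prime_period (X : Type) (T : X -> X) (p : nat) (x : X) : Prop :=
  [/\ (0 < p)%N, periodic_point T p x &
    forall q : nat, (0 < q)%N -> periodic_point T q x -> (p <= q)%N].

(* Main.v *)
(* A closed polygon is at least twice as long as the distance between any two
   of its vertices. If T has no fixed point then, since short prime periods are
   excluded, any k consecutive points of an orbit u are distinct; applying the
   contraction to them gives
     d(u_{n+1}, u_{n+2}) <= mu / (2 - (k - 1) mu) d(u_n, u_{n+1}),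
   a factor below 1 because k mu < 2. So u is injective and converges to some
   x, and the contraction applied to k - 1 consecutive points of u together
   with x gives (2 - mu) d(x, T x) <= 0 in the limit. Finally, k distinct fixed
   points would form a polygon of perimeter 0. *)
Require Import Defs.
From HB Require Import structures.
From mathcomp Require Import all_boot all_order all_algebra.
From mathcomp Require Import all_classical all_reals all_analysis.
From mathcomp Require Import finmap lra zify.

Set Implicit Arguments.
Unset Strict Implicit.
Unset Printing Implicit Defensive.

Import Order.TTheory GRing.Theory Num.Theory.
Import numFieldNormedType.Exports.

Local Open Scope classical_set_scope.
Local Open Scope card_scope.
Local Open Scope ring_scope.

Lemma mdist_path_le (R : realType) (X : metricType R) (z : nat -> X)
    (p q : nat) : (p <= q)%N ->
  mdist (z p) (z q) <= \sum_(p <= i < q) mdist (z i) (z i.+1).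
Proof.
move=> /subnK <-; elim: (q - p)%N => [|n IHn].
  by rewrite add0n mdistxx big_geq.
rewrite addSn big_nat_recr ?leq_addl//=.
by rewrite (le_trans (metric_triangle _ (z (n + p)%N) _))// lerD2r.
Qed.

(* Two vertices split a closed polygon into two paths joining them. *)
Lemma mdist_le_perimeter (R : realType) (X : metricType R) (k : nat)
    (x : 'I_k -> X) (p q : 'I_k) :
  2 * mdist (x p) (x q) <= perimeter x.
Proof.
case: k x p q => [x [] //|k x p q].
wlog pq : p q / (p <= q)%N.
  move=> H; have [/H//|/ltnW/H] := leqP p q.
  by rewrite metric_sym.
pose z n := x (inord n).
have zE (i : 'I_k.+1) : z i = x i by rewrite /z inord_val.
(* The closing side is split off so that the other sides form an interval sum, which can be cut at
   [p] and [q]; the second path runs from [q] through [k] and [0] to [p]. *)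
have -> : perimeter x =
    \sum_(0 <= i < k) mdist (z i) (z i.+1) + mdist (z k) (z 0%N).
  rewrite /perimeter big_ord_recr/= big_mkord; congr (_ + _).
    apply: eq_bigr => i _; rewrite -!zE/=.
    by rewrite modn_small// ltnS.
  by rewrite -!zE/= modnn.
have qk : (q <= k)%N by rewrite -ltnS.
rewrite -!zE (@big_cat_nat _ _ _ p)//=; last exact: leq_trans qk.
rewrite (@big_cat_nat _ _ _ q p k)//=.
have := mdist_path_le z (leq0n p).
have := mdist_path_le z pq.
have := mdist_path_le z qk.
have := metric_triangle (z q) (z k) (z p).
have := metric_triangle (z k) (z 0%N) (z p).
rewrite (metric_sym (z q) (z p)); lra.
Qed.

(** Indexing by [nat] lets orbit windows, a window completed by the limit, and an enumeration of
    fixed points all serve as polygons. *)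
Lemma kannan_dist_le (R : realType) (X : metricType R) (k : nat) (T : X -> X)
    (mu : R)
    (Tmu : forall x : 'I_k -> X, injective x ->
      perimeter (T \o x) <= mu * \sum_(i < k) mdist (x i) (T (x i)))
    (z : nat -> X) (p q : nat) :
  (forall i j, (i < j < k)%N -> z i <> z j) -> (p < k)%N -> (q < k)%N ->
  2 * mdist (T (z p)) (T (z q)) <= mu * \sum_(i < k) mdist (z i) (T (z i)).
Proof.
move=> zinj pk qk.
have xinj : injective (fun i : 'I_k => z i).
  move=> i j zij; apply/val_inj/eqP/negPn/negP; rewrite neq_ltn => /orP[] ij.
    by apply: (zinj i j) => //; rewrite ij/=.
  by apply: (zinj j i) => //; rewrite ij/=.
apply: (le_trans _ (Tmu _ xinj)).
exact: (mdist_le_perimeter (T \o (fun i : 'I_k => z i))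
  (Ordinal pk) (Ordinal qk)).
Qed.

Lemma cauchy_geometric (R : realType) (X : metricType R) (u : nat -> X)
    (a l : R) : 0 <= l -> l < 1 ->
  (forall n, mdist (u n) (u n.+1) <= a * l ^+ n) -> cauchy (u @ \oo).
Proof.
move=> l0 l1 ua; pose C := a / (1 - l).
have a0 : 0 <= a.
  by have := ua 0%N; rewrite expr0 mulr1; exact: (le_trans (mdist_ge0 _ _)).
have CE : C * (1 - l) = a by rewrite /C divfK// gt_eqF// subr_gt0.
have C0 : 0 <= C by rewrite divr_ge0// subr_ge0 ltW.
(* [C] sums the geometric series: [a + C * l = C] closes the induction on [p]. *)
have uC p n : mdist (u n) (u (n + p)%N) <= C * l ^+ n.
  elim: p n => [|p IHp] n.
    by rewrite addn0 mdistxx mulr_ge0// exprn_ge0.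
  rewrite (le_trans (metric_triangle _ (u n.+1) _))//.
  rewrite -addSnnS (le_trans (lerD (ua n) (IHp n.+1)))//.
  by rewrite exprS mulrA -mulrDl -CE mulrBr mulr1 subrK.
apply: cauchy_exP => e e0.
have /cvgrPdist_lt/(_ e e0)[N _ /(_ N (leqnn N))/=] :
    geometric C l @ \oo --> 0.
  by apply: cvg_geometric; rewrite ger0_norm.
rewrite sub0r normrN /= => /(le_lt_trans (ler_norm _)) CN.
exists (u N), N => // n /= Nn; rewrite ballEmdist/=.
by rewrite (le_lt_trans _ CN)// -(subnKC Nn).
Qed.

Lemma not_card_le_fset (T : choiceType) (A : set T) (n : nat) :
  ~ (A #<= `I_n) -> exists2 B : {fset T}, [set` B] `<=` A & (n < #|` B|)%N.
Proof.
move=> An; have [finA|/infinite_set_fset//] := pselect (finite_set A).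
exists (fset_set A); first by rewrite fset_setK.
have [m Am] := finA; rewrite (card_fset_set Am) ltnNge; apply/negP => mn.
by apply: An; rewrite (card_le_eql Am) card_le_II.
Qed.

(** The least period of [x] is at most [i < k], so the excluded periods leave only 1. *)
Lemma return_fixed (X : Type) (T : X -> X) (k : nat) (x : X) (i : nat) :
  (forall j, (2 <= j <= k - 1)%N -> ~ exists x : X, has_prime_period T j x) ->
  (0 < i < k)%N -> iter i T x = x -> T x = x.
Proof.
move=> noper /andP[i0 ik] Tix.
have exP : exists n, (0 < n)%N && `[< iter n T x = x >].
  by exists i; rewrite i0/=; apply/asboolP.
have [p /andP[p0 /asboolP Tpx] pmin] := ex_minnP exP.
have pP q : (0 < q)%N -> iter q T x = x -> (p <= q)%N.
  by move=> q0 qx; apply: pmin; rewrite q0; apply/asboolP.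
have pi := pP _ i0 Tix.
have [p1|p2] := leqP p 1.
  by have -> : T x = iter p T x by have -> : p = 1%N by lia.
exfalso; apply: (noper p); first lia.
by exists x.
Qed.

Section orbit.
Variables (R : realType) (X : metricType R) (k : nat) (T : X -> X) (mu : R).
Hypotheses (Xcomplete : complete_metric X) (k3 : (3 <= k)%N).
Hypotheses (mu0 : 0 <= mu) (muk : mu < 2 / k%:R).
Hypothesis Tmu : forall x : 'I_k -> X, injective x ->
  perimeter (T \o x) <= mu * \sum_(i < k) mdist (x i) (T (x i)).
Hypothesis noper : forall i : nat, (2 <= i <= k - 1)%N ->
  ~ exists x : X, has_prime_period T i x.
Hypothesis nofix : forall x, T x <> x.
Variable x0 : X.

Let u n := iter n T x0.
Let a n := mdist (u n) (u n.+1).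

Lemma orbit_window_inj n i j : (i < j < k)%N -> u (n + i) <> u (n + j).
Proof.
move=> /andP[ij jk] uij; apply: (nofix (x := u (n + i))).
apply: (@return_fixed _ _ k _ (j - i) noper); first lia.
by rewrite -iterD [RHS]uij; congr iter; lia.
Qed.

(** This is [k * mu < 2], split so as to give both the positive denominator [den] and the ratio
    [l < 1]. *)
Let k_mu : k.-1%:R * mu + mu < 2.
Proof.
have -> : k.-1%:R * mu + mu = mu * k%:R.
  by rewrite -[X in _ + X]mul1r -mulrDl natr1 prednK 1?mulrC//; lia.
by rewrite -ltr_pdivlMr// ltr0n; lia.
Qed.

Let den : 0 < 2 - k.-1%:R * mu.
Proof. by rewrite subr_gt0 (le_lt_trans _ k_mu)// lerDl. Qed.

Let natmul_sum (c : R) : k.-1%:R * c = \sum_(i < k.-1) c.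
Proof. by rewrite sumr_const card_ord mulr_natl. Qed.

(* Each side a_{n+i+1}, i < k - 1, of the image polygon is at most half its
   perimeter, hence at most mu S / 2 with S = a_n + ... + a_{n+k-1}; summing
   over i bounds S by a multiple of a_n. *)
Lemma orbit_contract n : a n.+1 <= mu / (2 - k.-1%:R * mu) * a n.
Proof.
pose S := \sum_(i < k) a (n + i)%N.
have aS i : (i < k.-1)%N -> 2 * a (n + i.+1)%N <= mu * S.
  move=> ik; have := @kannan_dist_le _ _ _ _ _ Tmu (fun i => u (n + i)) i i.+1
    (@orbit_window_inj n).
  have -> : (i < k)%N by lia.
  have -> : (i.+1 < k)%N by lia.
  move=> /(_ isT isT); rewrite /a addnS; exact.
have S_le : 2 * S <= 2 * a n + k.-1%:R * (mu * S).
  rewrite {1}/S; have -> : k = k.-1.+1 by lia.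
  rewrite big_ord_recl/= addn0 mulrDr lerD2l mulr_sumr.
  rewrite natmul_sum.
  by apply: ler_sum => i _; exact: aS.
rewrite mulrAC ler_pdivlMr//.
have := aS 0%N; rewrite addn1 => /(_ _) an.
have {}an : 2 * a n.+1 <= mu * S by apply: an; lia.
(* Scaling [S_le] by [mu] and [an] by the denominator makes [S] cancel. *)
have := ler_wpM2l mu0 S_le.
have := ler_wpM2r (ltW den) an.
move: (k.-1%:R) => r; lra.
Qed.

Lemma orbit_dist_gt0 n : 0 < a n.
Proof. by rewrite mdist_gt0; apply/eqP => /esym; exact: nofix. Qed.

Let l := mu / (2 - k.-1%:R * mu).

Let l01 : 0 <= l < 1.
Proof.
rewrite divr_ge0 ?(ltW den)//= ltr_pdivrMr// mul1r.
by rewrite ltrBrDl.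
Qed.

Lemma orbit_dist_ltn n m : (n < m)%N -> a m < a n.
Proof.
have aS i : a i.+1 < a i.
  apply: le_lt_trans (orbit_contract i) _.
  by rewrite gtr_pMl ?orbit_dist_gt0//; case/andP: l01.
move=> /subnK <-; elim: (m - n.+1)%N => [|i].
  by rewrite add0n.
by rewrite addSn; apply: lt_trans.
Qed.

(** Equal points have equal next steps, but the step lengths [a] strictly decrease. *)
Lemma orbit_inj : injective u.
Proof.
move=> n m unm; have anm : a n = a m by rewrite /a /u /= -!/(u _) unm.
have [/orbit_dist_ltn|/orbit_dist_ltn|//] := ltngtP n m;
  by rewrite anm ltxx.
Qed.

Lemma orbit_cauchy : cauchy (u @ \oo).
Proof.
have /andP[l0 l1] := l01; apply: (@cauchy_geometric _ _ _ (a 0%N) _ l0 l1).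
elim=> [|n IH]; first by rewrite mulr1.
by rewrite exprS mulrCA (le_trans (orbit_contract n))// ler_wpM2l.
Qed.

Lemma orbit_limit_absurd : False.
Proof.
have [x ux] := Xcomplete orbit_cauchy.
(* An injective orbit meets [x] at most once, so a tail avoids it. *)
have [N uN] : exists N, forall n, (N <= n)%N -> u n <> x.
  have [[m um]|um] := pselect (exists m, u m = x).
    exists m.+1 => n mn un; move: mn.
    by rewrite -um in un; rewrite (orbit_inj un) ltnn.
  by exists 0%N => n _ un; apply: um; exists n.
pose D := mdist x (T x).
have D0 : 0 < D by rewrite mdist_gt0; apply/eqP => /esym; exact: nofix.
(* With [e = D / 7], the final estimate reads [2 * D < 6 * e + mu * D]; since [mu <= 2 / 3], any
   [e <= 2 * D / 9] is contradictory. *)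
have e0 : 0 < D / 7 by lra.
have [M _ uM] := metricType_numDomainType.cvgr_dist_lt ux e0.
pose n := maxn N M.
have un i : mdist x (u (n + i)%N) < D / 7 by apply: uM => /=; lia.
(* The limit is the last vertex, at index [k.-1]; the contraction will bound the distance from its
   image to [u n.+1]. *)
pose z i := if (i < k.-1)%N then u (n + i)%N else x.
have zinj i j : (i < j < k)%N -> z i <> z j.
  move=> /andP[ij jk]; rewrite /z; have -> : (i < k.-1)%N by lia.
  case: ifP => _; last by apply: uN; lia.
  by move=> /orbit_inj; lia.
have := @kannan_dist_le _ _ _ _ _ Tmu z 0%N k.-1 zinj.
have -> : (0 < k)%N by lia.
have -> : (k.-1 < k)%N by lia.
move=> /(_ isT isT).
have -> : \sum_(i < k) mdist (z i) (T (z i)) = \sum_(i < k.-1) a (n + i)%N + D.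
  have -> : k = k.-1.+1 by lia.
  rewrite big_ord_recr/= /z ltnn; congr (_ + _).
  by apply: eq_bigr => i _; rewrite ltn_ord.
rewrite /z ltnn; have -> : (0 < k.-1)%N by lia.
have sum_le : \sum_(i < k.-1) a (n + i)%N <= k.-1%:R * (2 * (D / 7)).
  rewrite natmul_sum.
  apply: ler_sum => i _; rewrite /a.
  rewrite (le_trans (metric_triangle _ x _))//.
  rewrite metric_sym; have := un i; have := un i.+1; rewrite addnS; lra.
have := metric_triangle x (u n.+1) (T x).
have := un 1%N; rewrite addn1 addn0 -/D /= -/(u n).
rewrite /u/= -/(u n).
(* Together with [k_mu] this yields [3 * mu < 2], the source of [2 / 3] below. *)
have k1 : 2 <= k.-1%:R :> R by rewrite ler_nat; lia.
have mu_le : 2 * mu <= k.-1%:R * mu by rewrite ler_wpM2r.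
have mus := ler_wpM2l mu0 sum_le.
move: (k.-1%:R) k_mu mu_le mus => r kmu mu_le mus.
have muD : mu * D <= 2 / 3 * D by rewrite ler_pM2r//; lra.
have mukD : (r * mu + mu) * D <= 2 * D by rewrite ler_pM2r// ltW.
rewrite mulrDr; lra.
Qed.

End orbit.

Theorem theorem3p7 (R : realType) (X : metricType R) (k : nat) (T : X -> X)
    (Xcomplete : complete_metric X)
    (X_ge3 : `I_3 #<= [set: X])
    (k_ge3 : (3 <= k)%N)
    (k_leX : `I_k #<= [set: X])
    (Tcontr : kannan_perimetric_contraction k T) :
  ((forall i : nat, (2 <= i <= k - 1)%N ->
      ~ exists x : X, has_prime_period T i x) ->
    exists x : X, T x = x) /\
  [set x : X | T x = x] #<= `I_(k - 1).
Proof.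
have [mu [mu0 muk Tmu]] := Tcontr; split=> [noper|].
  have [x0] : exists x : X, True.
    case/card_leP: X_ge3 => f.
    by exists (val (f (SigSub (mem_set (isT : `I_3 0%N))))).
  move=> _; apply: contrapT => nofix.
  by apply: (@orbit_limit_absurd _ _ _ _ _ Xcomplete k_ge3 mu0 muk Tmu noper) x0
    => x Tx; apply: nofix; exists x.
apply: contrapT => /not_card_le_fset[B BT kB].
have [x0 x0B] : exists x, x \in B by apply/fset0Pn; rewrite -cardfs_gt0; lia.
have {}kB : (k <= size B)%N by apply: leq_trans kB; lia.
(* The default [x0] is never reached, as only indices below [k <= size B] matter. *)
pose z i := nth x0 B i.
have Tz i : (i < k)%N -> T (z i) = z i.
  by move=> ik; apply: (BT (z i)); rewrite /= mem_nth// (leq_trans ik).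
have zinj i j : (i < j < k)%N -> z i <> z j.
  move=> /andP[ij jk] /eqP.
  by rewrite nth_uniq ?fset_uniq ?(leq_trans _ kB)//; lia.
have k0 : (0 < k)%N by lia.
have k1 : (1 < k)%N by lia.
have := @kannan_dist_le _ _ _ _ _ Tmu z 0%N 1%N zinj k0 k1.
rewrite big1 => [|i _]; last by rewrite Tz// mdistxx.
rewrite !Tz// mulr0 pmulr_rle0// leNgt mdist_gt0 negbK => /eqP.
by apply: zinj.
Qed.
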